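(* For every $n\ge 1$, the $n$-th cohomology space $H^n=Z^n/B^n$ of ascending graphs (graphs of type $(\cdot\le\cdot)$) for the coboundary operator $\partial$ has as a basis the (classes of the) elements $$\left\{R_{2k_1+1}\wedge R_{2k_2+1}\wedge\dots\wedge R_{2k_p+1}\ :\ 0\le k_1<k_2<\dots<k_p,\ \sum_{i=1}^p(2k_i+1)=n\right\},$$ where $R_k$ denotes the symmetric wheel of length $k$.
   Context: **Ascending graphs.** An aerial graph with $n$ vertices $1,\dots,n$ is a list of $n$ lists of arrows $\Delta=\big((\overrightarrow{1a^1_1},\dots,\overrightarrow{1a^1_{\ell_1}}),\dots,(\overrightarrow{na^n_1},\dots,\overrightarrow{na^n_{\ell_n}})\big)$, $a^i_k\in\{1,\dots,n\}$ (loops allowed; lists may be empty). $Deb(i)$ is the ordered list of the $\ell_i$ arrows starting at $i$ and $Fin(i)$ the collection of the $f_i$ arrows ending at $i$. $\Delta$ is ascending (of type $(\cdot\le\cdot)$) if each vertex $i$ is of type $(f_i\le\ell_i)$, meaning: $f_i<\ell_i$ if $\ell_i>1$, and $f_i\le\ell_i$ if $\ell_i\le1$. **Symmetric combinations.** A symmetric linear combination is a finite real linear combination $\delta=\sum_\Delta a_\Delta\Delta$ of ascending graphs with $n$ vertices such that: (i) $a_{\sigma(\Delta)}=\varepsilon(\sigma)a_\Delta$ for each permutation $\sigma$ of the arrows inside one list $Deb(i)$; (ii) for the transposition $\tau$ of two vertices $i<j$, $a_{\tau(\Delta)}=(-1)^{\ell_i\ell_j+(\ell_i+\ell_j)(\ell_{i+1}+\dots+\ell_{j-1})}a_\Delta$,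 where $\tau(\Delta)$ is obtained by replacing each arrow $\overrightarrow{ab}$ by $\overrightarrow{\tau(a)\tau(b)}$ and listing the blocks $Deb$ in increasing order of the starting vertex (keeping the order inside each block). **Non-compatible orders.** A graph whose total list of arrows is not arranged in blocks by increasing starting vertex (''non-compatible'') is identified with $\varepsilon(\sigma)$ times the compatible graph obtained by rearranging the blocks in increasing order of starting vertex (keeping the order inside blocks), $\sigma$ being the corresponding permutation of the arrows. **Splitting a vertex.** Let $\Delta$ be an ascending graph with $n$ vertices and $0\le i<j\le n$. Renumber the vertices of $\Delta$, preserving order, by $0,\dots,\hat j,\dots,n$, to get $\Delta(0,\dots\hat j\dots,n)$; vertex $i$ of it is the vertex $i+1$ of $\Delta$ and has outgoing list $(\overrightarrow{ic^i_1},\dots,\overrightarrow{ic^i_{\ell_{i+1}}})$. Let $I\subset Fin(i)$ in this renumbered graph, $0\le r\le\ell_{i+1}$, $1\le s,t\le r+1$. - $\Delta_{i,j}^{I,r,s}$ is the graph on $0,\dots,n$ obtained by replacing the block of $i$ by the two consecutive blocks: first the block of $i$, consisting of $\overrightarrow{ic^i_1},\dots,\overrightarrow{ic^i_r}$ with a new arrow $\overrightarrow{ij}$ inserted so as to be in position $s$; then the block of $j$, $\overrightarrow{jc^i_{r+1}},\dots,\overrightarrow{jc^i_{\ell_{i+1}}}$. The arrows in $I$ still end at $i$, the arrows of $Fin(i)\setminus I$ now end at $j$, all other ends are unchanged. - $\Delta_{j,i}^{I,r,t}$ is obtained by replacing the block of $i$ by the two consecutive blocks: first the block of $j$, consisting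 of $\overrightarrow{jc^i_1},\dots,\overrightarrow{jc^i_r}$ with a new arrow $\overrightarrow{ji}$ inserted in position $t$; then the block of $i$, $\overrightarrow{ic^i_{r+1}},\dots,\overrightarrow{ic^i_{\ell_{i+1}}}$. Again arrows in $I$ end at $i$ and those of $Fin(i)\setminus I$ end at $j$. Only those $I,r,s,t$ for which the resulting graph is again ascending (both $i$ and $j$ being of ascending type, the new arrow being counted) are kept. Such a graph $\Delta'$ contracts properly in $i$ to $\Delta$, written $\Delta'\xrightarrow[i]{prop}\Delta$, if either $\min\{\#Deb_{\Delta'}(i)+\#Fin_{\Delta'}(i),\ \#Deb_{\Delta'}(j)+\#Fin_{\Delta'}(j)\}>1$, or the new arrow is the only arrow having $i$ or $j$ as start or end. **The operator $\partial$.** $$\partial\Delta=-\sum_{0\le i<j\le n}\Big[\sum_{\Delta_{j,i}^{I,r,t}\xrightarrow[i]{prop}\Delta}\varepsilon_{j,i}^{r,t}\,\Delta_{j,i}^{I,r,t}+\sum_{\Delta_{i,j}^{I,r,s}\xrightarrow[i]{prop}\Delta}\varepsilon_{i,j}^{r,s}\,\Delta_{i,j}^{I,r,s}\Big],$$ where, with $q_a=\#Deb_{\Delta_{j,i}^{I,r,t}}(a)$ and $p_a=\#Deb_{\Delta_{i,j}^{I,r,s}}(a)$, $$\varepsilon_{j,i}^{r,t}=(-1)^{q_j(q_0+\dots+q_{j-1})}(-1)^{(q_j-1)(q_0+\dots+q_{i-1})}(-1)^{t-1},$$ $$\varepsilon_{i,j}^{r,s}=(-1)^{p_j(p_0+\dots+p_{j-1})}(-1)^{(p_j-1)(p_0+\dots+p_{i-1})}(-1)^{s-1}(-1)^{p_ip_j}.$$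 $\partial$ is extended linearly. Graphs on vertices $0,\dots,n$ are viewed as graphs on $1,\dots,n+1$ by order-preserving renumbering. **Cohomology.** $Z^n$ is the space of symmetric combinations $\delta$ of ascending graphs with $n$ vertices with $\partial\delta=0$; $B^n$ is the space of $\partial\beta$, $\beta$ a symmetric combination of ascending graphs with $n-1$ vertices ($B^1=0$); $H^n=Z^n/B^n$. **Wheels.** The simple wheel of length $k$ is $\Delta_k=\big((\overrightarrow{12}),(\overrightarrow{23}),\dots,(\overrightarrow{(k-1)k}),(\overrightarrow{k1})\big)$ ($\Delta_1$ is one vertex with a loop). The symmetric wheel is its symmetrization $R_k=\sum_{\sigma\in S_k}\varepsilon(\sigma)\sigma(\Delta_k)$ ($\sigma$ acting on vertex names, blocks listed in increasing order of the starting vertex). The product $R_{r_1}\wedge\dots\wedge R_{r_p}$ is the symmetrization $\sum_{\sigma\in S_n}\varepsilon(\sigma)\sigma(\Delta)$ (up to a nonzero normalization constant), $n=r_1+\dots+r_p$, of the disjoint union $\Delta$ of $\Delta_{r_1},\dots,\Delta_{r_p}$ (vertices numbered consecutively).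
   Formalization: The cohomology is taken on combinations of graphs without isolated vertices, since graphs with no arrows give extra classes in every degree; split graphs are taken in compatible order with no further sign for rearranging blocks, as the signs in the coboundary already include it. *)

(* Defs.v *)
From HB Require Import structures.
From mathcomp Require Import all_boot all_order all_algebra all_fingroup.
From mathcomp Require Import finmap monalg reals.

Set Implicit Arguments.
Unset Strict Implicit.
Unset Printing Implicit Defensive.

Import GRing.Theory Num.Theory.
Local Open Scope ring_scope.

(** * Aerial graphs *)

(* Vertices are numbered from 0.  [D a] is the ordered list Deb(a), each arrow
   being given by its end.  A graph in this sense is always compatible: its
   arrows are totally ordered block after block, by increasing start. *)
Definition graph (n : nat) : Type := {ffun 'I_n -> seq 'I_n}.

(* An arrow is its start together with its position in the block of the start,
   so that parallel arrows are distinct. *)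
Definition arrow n (D : graph n) : finType := {a : 'I_n & 'I_(size (D a))}.

Definition source n (D : graph n) (e : arrow D) : 'I_n := tag e.

Definition target n (D : graph n) (e : arrow D) : 'I_n :=
  tnth (in_tuple (D (tag e))) (tagged e).

Definition outdeg n (D : graph n) (a : 'I_n) : nat := size (D a).

Definition Fin n (D : graph n) (a : 'I_n) : {set arrow D} :=
  [set e | target e == a].

Definition indeg n (D : graph n) (a : 'I_n) : nat := #|Fin D a|.

Definition ascending n (D : graph n) : bool :=
  [forall a, if (1 < outdeg D a)%N then (indeg D a < outdeg D a)%N
             else (indeg D a <= outdeg D a)%N].

Definition isolated n (D : graph n) (a : 'I_n) : bool :=
  (outdeg D a == 0)%N && (indeg D a == 0)%N.

Definition relabel n (s : 'S_n) (D : graph n) : graph n :=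
  [ffun a => map s (D (s^-1%g a))].

Definition permute_block n (D : graph n) (i : 'I_n) (s : 'S_(size (D i))) :
    graph n :=
  [ffun a => if a == i then [seq tnth (in_tuple (D i)) (s k) | k : 'I_(size (D i))]
             else D a].

(** * Symmetric combinations *)

Definition comb (R : realType) (n : nat) := {malg R[graph n]}.

Definition swap_sign n (D : graph n) (i j : 'I_n) : nat :=
  (outdeg D i * outdeg D j
   + (outdeg D i + outdeg D j)
     * \sum_(a : 'I_n | (i < a)%N && (a < j)%N) outdeg D a)%N.

Definition symmetric_combination (R : realType) n (d : comb R n) : Prop :=
  [/\ forall D, D \in msupp d -> ascending D,
      forall (D : graph n) (i : 'I_n) (s : 'S_(size (D i))),
        d@_(permute_block s) = (-1) ^+ s * d@_D
    & forall (D : graph n) (i j : 'I_n), (i < j)%N ->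
        d@_(relabel (tperm i j) D) = (-1) ^+ swap_sign D i j * d@_D].

(** * Splitting a vertex *)

Definition insert (T : Type) (k : nat) (x : T) (l : seq T) : seq T :=
  take k l ++ x :: drop k l.

(* Here [i : 'I_n] is the vertex to be split and [j : 'I_n.+1], with [i < j],
   is the name of the new vertex.  [lift j] is the renumbering of the vertices
   by 0, ..., ^j, ..., n; since [i < j], [lift j i] has the same value as [i]. *)
Section Split.
Variables (n : nat) (D : graph n) (i : 'I_n) (j : 'I_n.+1).

Definition split_end (I : {set arrow D}) (e : arrow D) : 'I_n.+1 :=
  if (target e == i) && (e \notin I) then j else lift j (target e).

Definition split_block (I : {set arrow D}) (a : 'I_n) : seq 'I_n.+1 :=
  [seq split_end I (Tagged (fun b => 'I_(size (D b))) k) | k : 'I_(size (D a))].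

(* Positions are counted from 0: the [s] and [t] below are the usual ones
   minus 1. *)
Definition split_ij (I : {set arrow D}) (r s : nat) : graph n.+1 :=
  [ffun a => if unlift j a is Some b then
               if b == i then insert s j (take r (split_block I i))
               else split_block I b
             else drop r (split_block I i)].

Definition split_ji (I : {set arrow D}) (r t : nat) : graph n.+1 :=
  [ffun a => if unlift j a is Some b then
               if b == i then drop r (split_block I i)
               else split_block I b
             else insert t (lift j i) (take r (split_block I i))].

End Split.

Definition incident n (D : graph n) (a : 'I_n) : {set arrow D} :=
  [set e | (source e == a) || (target e == a)].

(* In a graph obtained by splitting, the new arrow is incident to [i] and to
   [j]; it is the only such arrow when there is exactly one of them. *)
Definition proper_at n (D : graph n) (i j : 'I_n) : bool :=
  (1 < minn (outdeg D i + indeg D i) (outdeg D j + indeg D j))%N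
  || (#|incident D i :|: incident D j| == 1)%N.

Definition outdeg_before n (D : graph n) (i : 'I_n) : nat :=
  \sum_(a : 'I_n | (a < i)%N) outdeg D a.

(* These signs are those of the permutation which sorts the arrows of the split
   graph from the order (new arrow, then the blocks of the graph before
   splitting, with the block of [i] cut in two) to the compatible order.  The
   rearrangement of the blocks is thus already accounted for. *)
Definition sign_ji n (D : graph n) (i j : 'I_n) (t : nat) : nat :=
  (outdeg D j * outdeg_before D j + (outdeg D j - 1) * outdeg_before D i + t)%N.

Definition sign_ij n (D : graph n) (i j : 'I_n) (s : nat) : nat :=
  (outdeg D j * outdeg_before D j + (outdeg D j - 1) * outdeg_before D i + s
   + outdeg D i * outdeg D j)%N.

(** * The coboundary operator *)

Definition split_sum_ji (R : realType) n (D : graph n) (i : 'I_n) (j : 'I_n.+1) :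
    comb R n.+1 :=
  \sum_(I : {set arrow D} | I \subset Fin D i)
  \sum_(r < (outdeg D i).+1) \sum_(t < r.+1)
    let D' := split_ji i j I r t in
    if ascending D' && proper_at D' (lift j i) j
    then (-1) ^+ sign_ji D' (lift j i) j t *: << D' >> else 0.

Definition split_sum_ij (R : realType) n (D : graph n) (i : 'I_n) (j : 'I_n.+1) :
    comb R n.+1 :=
  \sum_(I : {set arrow D} | I \subset Fin D i)
  \sum_(r < (outdeg D i).+1) \sum_(s < r.+1)
    let D' := split_ij i j I r s in
    if ascending D' && proper_at D' (lift j i) j
    then (-1) ^+ sign_ij D' (lift j i) j s *: << D' >> else 0.

Definition graph_coboundary (R : realType) n (D : graph n) : comb R n.+1 :=
  - \sum_(i < n) \sum_(j < n.+1 | (i < j)%N)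
      (split_sum_ji R D i j + split_sum_ij R D i j).

Definition partial (R : realType) n (d : comb R n) : comb R n.+1 :=
  \sum_(D <- msupp d) d@_D *: graph_coboundary R D.

(** * Cohomology *)

Definition cocycle (R : realType) n (d : comb R n) : Prop :=
  symmetric_combination d /\ partial d = 0.

Definition coboundary (R : realType) n : comb R n -> Prop :=
  match n with
  | m.+2 => fun d => exists2 b : comb R m.+1,
              symmetric_combination b & d = partial b
  | _ => fun d => d = 0
  end.

(* The graph reduced to one vertex without arrow is ascending and none of its
   splittings is, so it is a cocycle in degree 1 which is not a coboundary.  The
   computation by wheels concerns the classes of the cocycles without isolated
   vertices. *)
Definition no_isolated_vertex (R : realType) n (d : comb R n) : Prop :=
  forall D, D \in msupp d -> forall a, ~~ isolated D a.

Definition linear_combination (R : realType) (V : lmodType R) (K : choiceType)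
    (b : K -> V) (c : {malg R[K]}) : V :=
  \sum_(k <- msupp c) c@_k *: b k.

(* For subspaces [Z] and [B] of [V]: [B] is contained in [Z], and the classes
   of the [b k], which lie in [Z], form a basis of the quotient [Z / B]. *)
Definition quotient_basis (R : realType) (V : lmodType R) (Z B : V -> Prop)
    (K : choiceType) (b : K -> V) : Prop :=
  [/\ forall x, B x -> Z x,
      forall k, Z (b k),
      forall c : {malg R[K]}, B (linear_combination b c) -> c = 0
    & forall z, Z z ->
        exists c : {malg R[K]}, B (z - linear_combination b c)].

(** * Wheels *)

Definition simple_wheel (k : nat) : graph k := [ffun a => [:: ordS a]].

Definition disjoint_union m n (D : graph m) (E : graph n) : graph (m + n) :=
  [ffun a => match split a with
             | inl b => map (@lshift m n) (D b)
             | inr b => map (@rshift m n) (E b)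
             end].

Fixpoint wheel_union (rs : seq nat) : graph (sumn rs) :=
  if rs is r :: rs' then disjoint_union (simple_wheel r) (wheel_union rs')
  else [ffun=> [::]].

Definition cast_graph m n (e : m = n) (D : graph m) : graph n :=
  [ffun a => map (cast_ord e) (D (cast_ord (esym e) a))].

Definition symmetrization (R : realType) n (D : graph n) : comb R n :=
  \sum_(s : 'S_n) (-1) ^+ s *: << relabel s D >>.

Definition wheel_lengths (ks : seq nat) : seq nat := [seq k.*2.+1 | k <- ks].

Definition wheel_index (n : nat) : choiceType :=
  {ks : seq nat | sorted ltn ks && (sumn (wheel_lengths ks) == n)}.

Lemma wheel_index_sum n (x : wheel_index n) : sumn (wheel_lengths (val x)) = n.
Proof. by case: x => ks /= /andP[_ /eqP]. Qed.

Definition wheel_product (R : realType) n (x : wheel_index n) : comb R n :=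
  symmetrization R
    (cast_graph (wheel_index_sum x) (wheel_union (wheel_lengths (val x)))).

(* Main.v *)
Require Import Defs.
From mathcomp Require Import all_boot all_order all_algebra all_fingroup.
From mathcomp Require Import finmap monalg reals zify.

(** Every arrow has one start and one end, so the indegrees and the outdegrees of
a graph have the same sum.  In an ascending graph the former are bounded vertex
by vertex by the latter, strictly where the outdegree exceeds 1; hence they
agree everywhere and are at most 1 ([ascending_deg]).  An ascending graph
without isolated vertex is therefore the graph [perm_graph p] of a permutation
[p], and a symmetric combination of such graphs is a function on the symmetric
group which conjugation by [s] multiplies by the sign of [s]
([symmetric_perm_graphJ]).

The coboundary vanishes on these functions ([partial_eq0]).  Splitting a vertex
of a permutation inserts a point into a cycle, so the coefficient of the
coboundary at [q] is a sum over the points [j] moved by [q] of signed values at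
the permutation [r = q * tperm (q j) j], which fixes [j], with [j] deleted.
These values are equivariant under simultaneous conjugation of [r] and [j], up
to the sign.  If [q] is even then [r] is odd, and conjugating the single term by
[r], which preserves it, gives its opposite; if [q] is odd, conjugating the
whole sum by [q] does the same ([equivariant_sum_eq0]).  Counting arrows,
splittings neither create nor destroy the property of having an isolated vertex
([mcoeff_graph_coboundary_eq0]); so all the cocycles under consideration are
the symmetric combinations without isolated vertex, and all the coboundaries
are zero.

It remains to find a basis of the functions twisted by the sign.  They are
spanned by the antisymmetrized classes [wedge p] ([symmetric_sum_wedge]).  If
some odd permutation commutes with [p], then [wedge p] is zero; this happens as
soon as [p] has a cycle of even length or two cycles of the same odd length
([rigid_or_odd_centralizer]).  Otherwise [p] is determined up to conjugation by
the set of its cycle lengths ([rigid_conjugate]), so [wedge p] is a wheel product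
up to sign ([rigid_wheel]).  Conversely, a permutation whose cycles have distinct
odd lengths commutes with even permutations only ([rigid_centralizer_even]), so
that a disjoint union of such wheels has a nonzero coefficient in the wheel
product built from it, and it occurs in no other one
([wheel_product_separated]). *)

Set Implicit Arguments.
Unset Strict Implicit.
Unset Printing Implicit Defensive.

Import GRing.Theory Num.Theory.
Local Open Scope ring_scope.

(** * Permutations and their centralizers *)

Lemma porbit_semiconj (T U : finType) (s : {perm T}) (t : {perm U})
    (h : T -> U) x :
  (forall y, t (h y) = h (s y)) -> porbit t (h x) = h @: porbit s x.
Proof.
move=> th; have tX k : (t ^+ k)%g (h x) = h ((s ^+ k)%g x).
  by elim: k => [|k IH]; rewrite ?perm1 // !expgSr !permM IH th.
apply/setP => y; apply/porbitP/imsetP => [[k ->]|[z /porbitP[k ->] ->]].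
  by exists ((s ^+ k)%g x); rewrite ?mem_porbit.
by exists k.
Qed.

Section PermOrbits.
Variable T : finType.
Implicit Types (p q s : {perm T}) (x y : T).
Local Open Scope group_scope.

Lemma eq_perm_exp p x k l :
  ((p ^+ k) x == (p ^+ l) x) = (k == l %[mod #|porbit p x|]).
Proof.
set m := #|porbit p x|.
have m_gt0 : (0 < m)%N by rewrite lt0n card_porbit_neq0.
have modm e : (p ^+ e) x = (p ^+ (e %% m)) x.
  have perm_m : (p ^+ m) x = x by rewrite permX iter_porbit.
  have perm_mul c : (p ^+ (c * m)) x = x.
    by elim: c => [|c IH]; rewrite ?perm1 // mulSn expgD permM perm_m.
  by rewrite {1}(divn_eq e m) expgD permM perm_mul.
rewrite (modm k) (modm l) !permX.
rewrite -!(nth_traject p (ltn_pmod _ m_gt0)).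
by rewrite nth_uniq ?uniq_traject_porbit // size_traject ltn_pmod.
Qed.

Lemma perm_exp_fix p x k : ((p ^+ k) x == x) = (#|porbit p x| %| k)%N.
Proof.
by rewrite -[eqbRHS](perm1 x) -(expg0 p) eq_perm_exp mod0n.
Qed.

Lemma card_porbitJ p s x : #|porbit (p ^ s) (s x)| = #|porbit p x|.
Proof.
rewrite (porbit_semiconj (s := p)) => [|y]; last exact: permJ.
by rewrite card_imset //; apply: perm_inj.
Qed.

Lemma conjg_self s : s ^ s = s.
Proof. by rewrite conjgE mulKg. Qed.

Lemma odd_permX p k : (p ^+ k)%g = odd k && p :> bool.
Proof.
elim: k => [|k IH]; first by rewrite odd_perm1.
by rewrite expgS odd_permM IH /= -addTb andb_addl.
Qed.

(** The cycles of [p] have distinct odd lengths. *)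
Definition rigid p :=
  (forall x, odd #|porbit p x|) /\
  (forall x y, #|porbit p x| = #|porbit p y| -> y \in porbit p x).

(** A permutation commuting with [p] permutes the cycles of [p] and preserves
their lengths, so it stabilizes each of them and acts on it as a power of [p].
Its order divides a product of cycle lengths, hence is odd. *)
Lemma rigid_centralizer_even p s : rigid p -> p ^ s = p -> s = false :> bool.
Proof.
move=> [podd pinj] sp.
pose M := (\prod_(x : T) #|porbit p x|)%N.
have oddM : odd M by apply: (big_ind odd) => // a b; rewrite oddM => -> ->.
have sM : s ^+ M = 1.
  apply/permP => x; rewrite perm1.
  have /porbitP[k sx] : s x \in porbit p x.
    by apply: pinj; rewrite -[in RHS]sp card_porbitJ.
  have sX e : (s ^+ e) x = (p ^+ (k * e)) x.
    elim: e => [|e IH]; first by rewrite muln0.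
    have /commute_sym spX : commute s (p ^+ (k * e)).
      exact/commuteX/commute_sym/commgP/conjg_fixP.
    by rewrite expgSr permM IH -permM spX permM sx mulnS expgD permM.
  by apply/eqP; rewrite sX perm_exp_fix dvdn_mull // /M (bigD1 x) //= dvdn_mulr.
have : odd_perm (s ^+ M) = false by rewrite sM odd_perm1.
by rewrite odd_permX oddM.
Qed.

(** The witness is the permutation [c] which coincides with [p] on the cycle [C] of
[x] and is the identity elsewhere: a single cycle of even length. *)
Lemma even_porbit_centralizer p x :
  ~~ odd #|porbit p x| -> exists2 s : {perm T}, p ^ s = p & s.
Proof.
set C := porbit p x => evenC.
have pC y : (p y \in C) = (y \in C).
  by rewrite -!eq_porbit_mem -[p y]/((p ^+ 1) y) porbit_perm.
have pN : p \in 'N(C | 'P).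
  by apply/astabsP => y; rewrite /= apermE pC.
pose c := restr_perm C p.
have cE y : c y = if y \in C then p y else y.
  case: ifPn => yC; first exact: restr_permE.
  exact: (out_perm (restr_perm_on _ _)).
exists c.
  apply/conjg_fixP/commgP/permP => y; rewrite !permM !cE pC.
  by case: ifP.
have cX k : (c ^+ k) x = (p ^+ k) x.
  elim: k => [|k IH]; first by rewrite !perm1.
  by rewrite !expgSr !permM IH cE mem_porbit.
(* The sign of [c] is read off from its number of cycles, 1 + #|~: C|. *)
have porbits_c : porbits c = C |: [set [set y] | y in ~: C].
  have cC : porbit c x = C.
    by apply/setP => y; apply/porbitP/porbitP => -[k ->]; exists k; rewrite cX.
  have cNC y : y \notin C -> porbit c y = [set y].
    move=> yC; apply/setP => z; rewrite inE; apply/porbitP/eqP => [[k ->]|->].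
      elim: k => [|k IH]; first by rewrite perm1.
      by rewrite expgSr permM IH cE (negbTE yC).
    by exists 0%N; rewrite perm1.
  apply/setP => A; rewrite in_setU1; apply/imsetP/orP.
    case=> y _ ->; case: (boolP (y \in C)) => yC.
      by left; rewrite -cC eq_porbit_mem cC.
    by right; apply/imsetP; exists y; rewrite ?inE ?cNC.
  case=> [/eqP->|/imsetP[y]]; first by exists x; rewrite ?cC.
  by rewrite inE => yC ->; exists y; rewrite ?cNC.
have NC : C \notin [set [set y] | y in ~: C].
  apply/imsetP => -[y]; rewrite inE => yC CE.
  by move: yC; rewrite CE set11.
rewrite /odd_perm porbits_c cardsU1 NC card_imset; last exact: set1_inj.
rewrite -(cardsC C) !oddD; move: evenC; case: (odd #|C|) => //= _.
by case: (odd _).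
Qed.

(** The exchange of the two cycles, [(p ^+ k) x] against [(p ^+ k) y], is a product
of as many transpositions as their length. *)
Lemma twin_porbits_centralizer p x y :
  odd #|porbit p x| -> #|porbit p x| = #|porbit p y| -> y \notin porbit p x ->
  exists2 s : {perm T}, p ^ s = p & s.
Proof.
move=> oddx exy yNx; set m := #|porbit p x| in oddx.
pose t k := tperm ((p ^+ k) x) ((p ^+ k) y).
have xNy k l : (p ^+ k) x != (p ^+ l) y.
  apply: contra yNx => /eqP kl.
  by rewrite -eq_porbit_mem -(porbit_perm p l) -kl porbit_perm.
have t0C k : commute (t k) (t 0%N).
  apply/commgP/conjg_fixP; rewrite /t tpermJ !expg0 !perm1.
  case: (eqVneq ((p ^+ k) x) x) => [kx|kx].
    have /eqP -> : (p ^+ k) y == y.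
      by rewrite perm_exp_fix -exy -perm_exp_fix kx.
    by rewrite kx tpermL tpermR tpermC.
  rewrite !tpermD //.
  - by have := xNy 0%N k; rewrite expg0 perm1.
  - apply: contra kx => /eqP ky.
    by rewrite perm_exp_fix exy -perm_exp_fix -ky.
  - by rewrite eq_sym.
  - by have := xNy k 0%N; rewrite expg0 perm1 eq_sym.
pose P := \prod_(k < m) t k.
have PC : commute (t 0%N) P.
  apply: (big_ind (commute (t 0%N))) => [|a b|k _].
  - exact: commute1.
  - exact: commuteM.
  - exact/commute_sym.
exists P.
  have tm : t m = t 0%N by rewrite /t !permX iter_porbit /m exy iter_porbit.
  have Pp : P ^ p = \prod_(k < m) t k.+1.
    rewrite /P (big_morph (conjg^~ p) (fun a b => conjMg a b p) (conj1g p)).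
    by apply: eq_bigr => k _; rewrite tpermJ -!permM -!expgSr.
  (* Conjugation by [p] maps [t k] to [t k.+1], and [t m] is [t 0] again. *)
  have : t 0%N * P ^ p = P * t 0%N.
    rewrite Pp -[t 0%N in RHS]tm.
    by rewrite -[LHS](big_ord_recl m (fun k => t k)) big_ord_recr.
  rewrite -PC => /mulgI /conjg_fixP/commgP cPp.
  exact/conjg_fixP/commgP/commute_sym.
rewrite /P (big_morph (@odd_perm T) (@odd_permM T) (odd_perm1 T)).
rewrite (eq_bigr (fun=> true)); last by move=> k _; rewrite odd_tperm xNy.
by rewrite big_const_ord; elim: (m) oddx => //= k IH; rewrite -addTb.
Qed.

Lemma rigid_or_odd_centralizer p :
  rigid p \/ exists2 s : {perm T}, p ^ s = p & s.
Proof.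
case: (boolP [forall x, odd #|porbit p x|]) => [/forallP oddp|]; last first.
  by rewrite negb_forall => /existsP[x /even_porbit_centralizer]; right.
case: (boolP [forall x, forall y,
    (#|porbit p x| == #|porbit p y|) ==> (y \in porbit p x)]).
  move=> /'forall_forallP pinj; left; split=> // x y /eqP exy.
  exact: (implyP (pinj x y)).
rewrite negb_forall => /existsP[x]; rewrite negb_forall => /existsP[y].
rewrite negb_imply => /andP[/eqP exy yNx]; right.
exact: twin_porbits_centralizer (oddp x) exy yNx.
Qed.

(** Each cycle of [p] is matched with a cycle of [q] of the same length, with a
base point on either side ([r x] and [t x] below, which depend on the cycle of
[x] only), and [(p ^+ k) (r x)] is sent to [(q ^+ k) (t x)]. *)
Lemma rigid_conjugate p q : rigid p ->
  (forall x, exists y, #|porbit q y| = #|porbit p x|) ->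
  exists s : {perm T}, q = p ^ s.
Proof.
move=> [_ pinj] pq.
have rep_ex x : exists y, y \in porbit p x by exists x; apply: porbit_id.
have img_ex x : exists y, #|porbit q y| == #|porbit p x|.
  by have [y /eqP] := pq x; exists y.
pose r x := xchoose (rep_ex x); pose t x := xchoose (img_ex x).
have rP x : porbit p (r x) = porbit p x.
  by apply/eqP; rewrite eq_porbit_mem (xchooseP (rep_ex x)).
have tP x : #|porbit q (t x)| = #|porbit p x|.
  exact/eqP/(xchooseP (img_ex x)).
have eq_rt x y : porbit p x = porbit p y -> r x = r y /\ t x = t y.
  by move=> xy; split; apply: eq_xchoose => z; rewrite xy.
have log_ex x : exists k, (p ^+ k) (r x) == x.
  have /porbitP[k xk] : x \in porbit p (r x) by rewrite rP porbit_id.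
  by exists k; rewrite -xk.
pose k x := xchoose (log_ex x).
have kP x : (p ^+ k x) (r x) = x by exact/eqP/(xchooseP (log_ex x)).
have same_exp x a b :
    ((p ^+ a) (r x) == (p ^+ b) (r x)) = ((q ^+ a) (t x) == (q ^+ b) (t x)).
  by rewrite !eq_perm_exp rP tP.
pose f x := (q ^+ k x) (t x).
have f_inj : injective f.
  move=> x y fxy.
  have /pinj : #|porbit p x| = #|porbit p y|.
    by rewrite -!tP -(porbit_perm q (k x)) -/(f x) fxy porbit_perm.
  rewrite -eq_porbit_mem => /eqP /esym /eq_rt[rxy txy].
  rewrite -(kP x) -(kP y) -rxy; apply/eqP.
  by rewrite same_exp txy -/(f y) -fxy /f txy.
exists (perm f_inj); apply/permP => y.
have [x ->] : exists x, y = perm f_inj x.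
  by exists ((perm f_inj)^-1 y); rewrite permKV.
rewrite permJ !permE.
have /eq_rt[rpx tpx] : porbit p (p x) = porbit p x.
  exact: (porbit_perm p 1 x).
rewrite /f -permM -expgSr tpx; apply/eqP.
by rewrite -same_exp expgSr permM kP -rpx kP.
Qed.

End PermOrbits.

(** * Ascending graphs are partial permutations *)

Definition perm_graph n (p : 'S_n) : graph n := [ffun a => [:: p a]].

Definition has_isolated n (D : graph n) := [exists a, isolated D a].

Lemma perm_graph_inj n : injective (@perm_graph n).
Proof.
move=> p q /ffunP pq; apply/permP => a.
by have := pq a; rewrite !ffunE => -[].
Qed.

Lemma relabel_perm_graph n (s p : 'S_n) :
  relabel s (perm_graph p) = perm_graph (p ^ s).
Proof. by apply/ffunP => a; rewrite !ffunE /= !permM. Qed.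

Lemma relabelK n (s : 'S_n) : cancel (@relabel n s) (relabel s^-1).
Proof.
move=> D; apply/ffunP => a; rewrite !ffunE invgK permK -map_comp.
by apply: map_id_in => x _ /=; rewrite permK.
Qed.

Section Degrees.
Variable n : nat.
Implicit Types (D : graph n) (p : 'S_n).

Lemma sum_outdeg D : (\sum_a outdeg D a)%N = #|{: arrow D}|.
Proof.
rewrite card_tagged sumnE big_map big_enum /=.
by apply: eq_bigr => a _; rewrite card_ord.
Qed.

Lemma sum_indeg D : (\sum_a indeg D a)%N = #|{: arrow D}|.
Proof.
rewrite -sum1_card (partition_big (@target n D) xpredT) //=.
apply: eq_bigr => a _; rewrite /indeg -sum1_card.
by apply: eq_bigl => e; rewrite inE.
Qed.

(** The two degrees have the same sum, so the bound of one by the other is an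
equality at each vertex; this excludes outdegrees above 1, where it is strict. *)
Lemma ascending_deg D a :
  ascending D -> indeg D a = outdeg D a /\ (outdeg D a <= 1)%N.
Proof.
move=> /forallP ascD.
have le b : (indeg D b <= outdeg D b)%N.
  by have := ascD b; case: ifP => // _ /ltnW.
have eqD : indeg D a = outdeg D a.
  have [_] : (\sum_b indeg D b <= \sum_b outdeg D b
                ?= iff [forall b, indeg D b == outdeg D b])%N.
    by apply: leqif_sum => b _; apply: leqif_eq.
  by rewrite sum_indeg sum_outdeg eqxx => /esym/forallP/(_ a)/eqP.
split=> //; have := ascD a; case: ltnP => //.
by rewrite eqD ltnn.
Qed.

Lemma outdeg_ascending D a :
  ascending D -> ~~ has_isolated D -> outdeg D a = 1%N.
Proof.
move=> /(ascending_deg a)[inout out1]; rewrite negb_exists => /forallP/(_ a).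
by rewrite /isolated inout andbb; case: outdeg out1 => [|[]].
Qed.

Lemma has_isolated_sum_outdeg D :
  ascending D -> has_isolated D = (\sum_a outdeg D a < n)%N.
Proof.
move=> ascD; case: ltnP => [lt_n|].
  apply: contraTT lt_n => noiso; rewrite -leqNgt.
  under eq_bigr do rewrite outdeg_ascending //.
  by rewrite sum1_card card_ord.
apply: contraTF => /existsP[a /andP[/eqP out0 _]]; rewrite -ltnNge.
rewrite (bigD1 a) //= out0 add0n.
have cardn : n = (\sum_(b < n | b != a) 1).+1.
  by rewrite -[LHS]card_ord -sum1_card (bigD1 a).
rewrite [X in (_ < X)%N]cardn ltnS.
by apply: leq_sum => b _; case: (ascending_deg b ascD).
Qed.

Lemma perm_graph_outdeg p a : outdeg (perm_graph p) a = 1%N.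
Proof. by rewrite /outdeg ffunE. Qed.

Lemma ascending_perm_graph D :
  ascending D -> ~~ has_isolated D -> exists p, D = perm_graph p.
Proof.
move=> ascD isoD.
have size1 a : size (D a) = 1%N by exact: outdeg_ascending.
pose e a : arrow D := Tagged _ (cast_ord (esym (size1 a)) ord0).
have De a : D a = [:: target (e a)].
  rewrite /target /= (tnth_nth (target (e a))) /=.
  by case: (D a) (size1 a) => [|x []].
have inj : injective (fun a => target (e a)).
  move=> a b ab; apply/eqP/negPn/negP => aNb.
  have : (#|[set e a; e b]| <= indeg D (target (e a)))%N.
    apply: subset_leq_card; apply/subsetP => x.
    by rewrite !inE => /orP[]/eqP -> //; rewrite ab.
  rewrite (ascending_deg _ ascD).1 outdeg_ascending // cards2.
  suff -> : e a != e b by [].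
  by apply: contra aNb => /eqP/(congr1 (@source n D))/eqP.
exists (perm inj); apply/ffunP => a.
by rewrite ffunE permE De.
Qed.

Lemma perm_graph_target p (e : arrow (perm_graph p)) : target e = p (source e).
Proof.
case: e => a k; rewrite /target /source /= (tnth_nth (p a)) /=.
have : nat_of_ord k = 0%N by case: k => k /=; rewrite ffunE ltnS leqn0 => /eqP.
by move=> ->; rewrite {1}ffunE.
Qed.

Lemma perm_graph_source_inj p : injective (@source n (perm_graph p)).
Proof.
move=> [a k] [b l]; rewrite /source /= => ab; subst b; congr Tagged.
apply: val_inj => /=.
case: k l => k + [l] /=; rewrite ffunE !ltnS !leqn0.
by move=> /eqP-> /eqP->.
Qed.

Lemma perm_graph_source_surj p a :
  exists e : arrow (perm_graph p), source e = a.
Proof.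
have size1 : size (perm_graph p a) = 1%N by rewrite ffunE.
pose k := cast_ord (esym size1) ord0.
by exists (Tagged (fun b => 'I_(size (perm_graph p b))) k).
Qed.

Lemma perm_graph_indeg p a : indeg (perm_graph p) a = 1%N.
Proof.
have [e se] := perm_graph_source_surj p (p^-1%g a).
rewrite /indeg -(cards1 e); congr (#|pred_of_set _|).
apply/setP => x; rewrite !inE perm_graph_target.
rewrite -(inj_eq (@perm_graph_source_inj p)) se.
by apply/eqP/eqP => [<-|->]; rewrite ?permK ?permKV.
Qed.

Lemma perm_graph_ascending p : ascending (perm_graph p).
Proof. by apply/forallP => a; rewrite perm_graph_outdeg perm_graph_indeg. Qed.

Lemma perm_graph_no_isolated p : ~~ has_isolated (perm_graph p).
Proof.
by rewrite negb_exists; apply/forallP => a; rewrite /isolated perm_graph_outdeg.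
Qed.

End Degrees.

Lemma no_isolated_vertexP (R : realType) n (d : comb R n) D :
  no_isolated_vertex d -> D \in msupp d -> ~~ has_isolated D.
Proof.
by move=> noiso suppD; rewrite negb_exists; apply/forallP => a; apply: noiso.
Qed.

(** * Symmetric combinations of permutations *)

Lemma eq_opp0 (R : realType) (x : R) : x = - x -> x = 0.
Proof. by move/eqP; rewrite -addr_eq0 -mulr2n mulrn_eq0 => /eqP. Qed.

Section Symmetric.
Variables (R : realType) (n : nat).
Implicit Types (d : comb R n) (p q s : 'S_n) (D : graph n).

Lemma swap_sign_perm_graph p (i j : 'I_n) : odd (swap_sign (perm_graph p) i j).
Proof. by rewrite /swap_sign !perm_graph_outdeg; lia. Qed.

Lemma symmetric_perm_graphJ d p s :
  symmetric_combination d ->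
  d@_(perm_graph (p ^ s)) = (-1) ^+ s * d@_(perm_graph p).
Proof.
move=> [_ _ symd].
have swap q (i j : 'I_n) : i != j ->
    d@_(perm_graph (q ^ tperm i j)) = - d@_(perm_graph q).
  wlog ij : i j / (i < j)%N.
    move=> wl ij; case: (ltngtP i j) => [/wl->//|ji|/val_inj e].
      by rewrite tpermC wl // eq_sym.
    by rewrite e eqxx in ij.
  move=> _; rewrite -relabel_perm_graph symd //.
  by rewrite -signr_odd swap_sign_perm_graph expr1 mulN1r.
have [ts -> {s} dts] := prod_tpermP s.
elim: ts p dts => [|[i j] ts IH] p /=.
  by rewrite big_nil conjg1 odd_perm1 mul1r.
case/andP=> ij dts; rewrite big_cons conjgM IH // swap //.
by rewrite odd_permM odd_tperm ij signrN mulrN mulNr.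
Qed.

Definition wedge p : comb R n := symmetrization R (perm_graph p).

Lemma mcoeff_wedge p D :
  (wedge p)@_D = \sum_s (-1) ^+ odd_perm s * (perm_graph (p ^ s)%g == D)%:R.
Proof.
rewrite /wedge /symmetrization raddf_sum /=; apply: eq_bigr => s _.
by rewrite mcoeffZ mcoeffU relabel_perm_graph.
Qed.

Lemma mcoeff_wedgeJ p q s :
  (wedge p)@_(perm_graph (q ^ s)) = (-1) ^+ s * (wedge p)@_(perm_graph q).
Proof.
rewrite !mcoeff_wedge mulr_sumr (reindex_inj (mulIg s)) /=.
apply: eq_bigr => t _; rewrite odd_permM signr_addb mulrA [(-1) ^+ s * _]mulrC.
congr (_ * _%:R).
by rewrite conjgM !(inj_eq (@perm_graph_inj n)) (inj_eq (conjg_inj s)).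
Qed.

Lemma wedgeJ p s : wedge (p ^ s) = (-1) ^+ s *: wedge p.
Proof.
apply/malgP => D; rewrite mcoeffZ !mcoeff_wedge mulr_sumr.
rewrite [RHS](reindex_inj (mulgI s)) /=; apply: eq_bigr => t _.
by rewrite odd_permM signr_addb !mulrA -signr_addb addbb mul1r conjgM.
Qed.

Lemma wedge_eq0 p s : (p ^ s)%g = p -> s -> wedge p = 0.
Proof.
move=> ps odds; have := wedgeJ p s; rewrite ps odds expr1 scaleN1r => pN.
apply/malgP => D; rewrite mcoeff0; apply: eq_opp0.
by rewrite {1}pN mcoeffN.
Qed.

Lemma msupp_wedge p D : D \in msupp (wedge p) -> exists s, D = perm_graph (p ^ s).
Proof.
rewrite -mcoeff_neq0 mcoeff_wedge => nz.
case: (pickP (fun s => perm_graph (p ^ s) == D)) => [s /eqP <-|no].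
  by exists s.
by rewrite big1 ?eqxx // in nz => s _; rewrite no mulr0.
Qed.

Lemma wedge_symmetric p : symmetric_combination (wedge p).
Proof.
split.
- by move=> D /msupp_wedge[s ->]; apply: perm_graph_ascending.
- move=> D i s.
  case: (leqP (size (D i)) 1) => sizeDi.
    have s1 : s = 1%g.
      apply/permP => k; apply: val_inj; rewrite perm1.
      case: k (s k) => k /= lek [l /= lel]; lia.
    rewrite s1 odd_perm1 mul1r; congr mcoeff; apply/ffunP => a; rewrite ffunE.
    case: eqP => // ->; rewrite -[RHS](map_tnth_enum (in_tuple (D i))).
    by apply: eq_map => k; rewrite perm1.
  have sizeP : size (permute_block s i) = size (D i).
    by rewrite ffunE eqxx size_map size_enum_ord.
  suff nosupp D' : (1 < size (D' i))%N -> (wedge p)@_D' = 0.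
    by rewrite !nosupp ?sizeP ?mulr0.
  move=> big; apply: mcoeff_outdom; apply/negP => /msupp_wedge[t D't].
  by rewrite D't ffunE in big.
- move=> D i j ij.
  case: (boolP [exists q, D == perm_graph q]) => [/existsP[q /eqP ->]|nq].
    rewrite relabel_perm_graph mcoeff_wedgeJ odd_tperm.
    rewrite -(signr_odd _ (swap_sign _ _ _)) swap_sign_perm_graph; suff -> : i != j by [].
    by apply: contraTneq ij => ->; rewrite ltnn.
  have nosupp D' : ~~ [exists q, D' == perm_graph q] -> (wedge p)@_D' = 0.
    move=> nq'; apply: mcoeff_outdom; apply: contra nq' => /msupp_wedge[t ->].
    by apply/existsP; exists (p ^ t)%g.
  rewrite !nosupp ?mulr0 //; apply: contra nq => /existsP[q /eqP Dq].
  apply/existsP; exists (q ^ (tperm i j)^-1)%g.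
  by rewrite -relabel_perm_graph -Dq relabelK.
Qed.

Lemma wedge_no_isolated p : no_isolated_vertex (wedge p).
Proof.
move=> D /msupp_wedge[s ->] a.
have := perm_graph_no_isolated (p ^ s).
by rewrite negb_exists => /forallP/(_ a).
Qed.

(** The right-hand side is the average of the combinations obtained from [d] by
conjugating its terms, with the sign, and each of them is [d] itself. *)
Lemma symmetric_sum_wedge d : symmetric_combination d -> no_isolated_vertex d ->
  d = \sum_p (d@_(perm_graph p) / n`!%:R) *: wedge p.
Proof.
move=> symd noiso; apply/malgP => D; rewrite raddf_sum /=.
case: (boolP [exists q, D == perm_graph q]) => [/existsP[q /eqP ->]|nq].
  transitivity (\sum_(s : 'S_n) d@_(perm_graph q) / n`!%:R).
    have n_fact : (n`!%:R : R) != 0 by rewrite pnatr_eq0 -lt0n fact_gt0.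
    by rewrite sumr_const card_Sn -[RHS]mulr_natr divfK.
  under [RHS]eq_bigr => p _ do rewrite mcoeffZ mcoeff_wedge mulr_sumr.
  rewrite exchange_big /=; apply: eq_bigr => s _.
  rewrite (bigD1 (q ^ s^-1)%g) //= conjgKV eqxx mulr1.
  rewrite symmetric_perm_graphJ // big1.
    by rewrite odd_permV addr0 [RHS]mulrC !mulrA -signr_addb addbb mul1r.
  move=> p pq; case: eqP => [/perm_graph_inj eq_q|]; last by rewrite !mulr0.
  by rewrite -eq_q conjgK eqxx in pq.
rewrite big1; last first.
  move=> p _; rewrite mcoeffZ [X in _ * X]mcoeff_outdom ?mulr0 //.
  by apply: contra nq => /msupp_wedge[t ->]; apply/existsP; exists (p ^ t)%g.
apply: mcoeff_outdom; apply: contra nq => suppD.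
have [asc _ _] := symd.
have [q ->] := ascending_perm_graph (asc _ suppD) (no_isolated_vertexP noiso suppD).
by apply/existsP; exists q.
Qed.

End Symmetric.

(** * Splitting a vertex *)

Section Splitting.
Variables (R : realType) (n : nat).

Section AnyGraph.
Variables (D : graph n) (i : 'I_n) (j : 'I_n.+1).
Implicit Types (I : {set arrow D}).

Lemma size_split_block I a : size (split_block i j I a) = outdeg D a.
Proof. by rewrite size_map size_enum_ord. Qed.

Lemma size_insert (T : Type) k (x : T) l : size (insert k x l) = (size l).+1.
Proof. by rewrite /insert size_cat /= addnS -size_cat cat_take_drop. Qed.

Lemma sum_outdeg_split_ji I r t :
  (\sum_a outdeg (split_ji i j I r t) a = (\sum_a outdeg D a).+1)%N.
Proof.
rewrite (bigD1_ord j) //= (bigD1 i) //= [in RHS](bigD1 i) //=.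
rewrite /outdeg !ffunE unlift_none liftK eqxx size_insert.
rewrite addnA addSn -size_cat cat_take_drop size_split_block addSn.
congr (_ + _).+1.
by apply: eq_bigr => b bi; rewrite ffunE liftK (negbTE bi) size_split_block.
Qed.

Lemma sum_outdeg_split_ij I r s :
  (\sum_a outdeg (split_ij i j I r s) a = (\sum_a outdeg D a).+1)%N.
Proof.
rewrite (bigD1_ord j) //= (bigD1 i) //= [in RHS](bigD1 i) //=.
rewrite /outdeg !ffunE unlift_none liftK eqxx size_insert.
rewrite addnA addnS [(size (drop _ _) + _)%N]addnC -size_cat cat_take_drop.
rewrite size_split_block addSn; congr (_ + _).+1.
by apply: eq_bigr => b bi; rewrite ffunE liftK (negbTE bi) size_split_block.
Qed.

(** The contribution to the coefficient at [E] of a splitting [D'] whose sign has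
exponent [e]. *)
Definition split_term (D' E : graph n.+1) (e : nat) : R :=
  if [&& ascending D', proper_at D' (lift j i) j & D' == E] then (-1) ^+ e
  else 0.

Lemma mcoeff_split_sum_ji E : (split_sum_ji R D i j)@_E =
  \sum_(I : {set arrow D} | I \subset Fin D i)
  \sum_(r < (outdeg D i).+1) \sum_(t < r.+1)
    split_term (split_ji i j I r t) E
      (sign_ji (split_ji i j I r t) (lift j i) j t).
Proof.
rewrite raddf_sum; apply: eq_bigr => I _.
rewrite raddf_sum; apply: eq_bigr => r _.
rewrite raddf_sum; apply: eq_bigr => t _; rewrite /split_term andbA.
case: ifP => _ /=; last by rewrite mcoeff0.
by rewrite mcoeffZ mcoeffU; case: eqP; rewrite ?mulr1 ?mulr0.
Qed.

Lemma mcoeff_split_sum_ij E : (split_sum_ij R D i j)@_E =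
  \sum_(I : {set arrow D} | I \subset Fin D i)
  \sum_(r < (outdeg D i).+1) \sum_(s < r.+1)
    split_term (split_ij i j I r s) E
      (sign_ij (split_ij i j I r s) (lift j i) j s).
Proof.
rewrite raddf_sum; apply: eq_bigr => I _.
rewrite raddf_sum; apply: eq_bigr => r _.
rewrite raddf_sum; apply: eq_bigr => t _; rewrite /split_term andbA.
case: ifP => _ /=; last by rewrite mcoeff0.
by rewrite mcoeffZ mcoeffU; case: eqP; rewrite ?mulr1 ?mulr0.
Qed.

Lemma split_term_eq0 D' E e : ascending D ->
  (\sum_a outdeg D' a = (\sum_a outdeg D a).+1)%N ->
  (ascending E -> has_isolated E != has_isolated D) -> split_term D' E e = 0.
Proof.
move=> ascD sumD' isoE; rewrite /split_term.
case: and3P => // -[ascD' _ /eqP E_D'].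
move: isoE; rewrite -E_D' => /(_ ascD').
by rewrite !has_isolated_sum_outdeg // sumD' ltnS eqxx.
Qed.

End AnyGraph.

Implicit Types (D : graph n) (E : graph n.+1).

Lemma mcoeff_graph_coboundary D E : (graph_coboundary R D)@_E =
  - \sum_(i < n) \sum_(j < n.+1 | (i < j)%N)
      ((split_sum_ji R D i j)@_E + (split_sum_ij R D i j)@_E).
Proof.
rewrite mcoeffN raddf_sum; congr (- _); apply: eq_bigr => i _.
by rewrite raddf_sum; apply: eq_bigr => j _; rewrite /= mcoeffD.
Qed.

(** A splitting adds one vertex and one arrow, and an ascending graph has an
isolated vertex exactly when it has fewer arrows than vertices. *)
Lemma mcoeff_graph_coboundary_eq0 D E : ascending D ->
  (ascending E -> has_isolated E != has_isolated D) ->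
  (graph_coboundary R D)@_E = 0.
Proof.
move=> ascD isoE; rewrite mcoeff_graph_coboundary big1 ?oppr0 // => i _.
rewrite big1 // => j _; rewrite mcoeff_split_sum_ji mcoeff_split_sum_ij.
rewrite !big1 ?addr0 // => I _; rewrite big1 // => r _; rewrite big1 // => t _;
  apply: (split_term_eq0 (D := D)) => //.
- exact: sum_outdeg_split_ij.
- exact: sum_outdeg_split_ji.
Qed.

End Splitting.

(** * Splitting a vertex of a permutation *)

(** The splittings of a permutation [p] at [i] which are ascending insert the new
point [j] just before or just after [i] in its cycle.  As [lift_perm j j p] is [p]
on the other points and fixes [j], these are the products of [lift_perm j j p]
with the transposition of [i] and [j], on either side. *)
Section SplitPermutation.
Variables (R : realType) (n : nat) (p : 'S_n) (i : 'I_n) (j : 'I_n.+1).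
Implicit Types (I : {set arrow (perm_graph p)}) (q : 'S_n.+1).

Local Notation t_ij := (tperm (lift j i) j).

Lemma split_block_perm_graph I (e : arrow (perm_graph p)) :
  split_block i j I (source e) = [:: split_end i j I e].
Proof.
case: e => a k; rewrite /source /split_block /=.
have enum1 m (l : 'I_m) : m = 1%N -> enum 'I_m = [:: l].
  move=> m1; subst m.
  by rewrite enum_ordSl (ord1 l) (size0nil (size_enum_ord 0)).
by rewrite /image_mem (enum1 _ k) // ffunE.
Qed.

Lemma split_ji_perm_graph :
  split_ji (D := perm_graph p) i j set0 0 0 = perm_graph (lift_perm j j p * t_ij).
Proof.
apply/ffunP => a; rewrite !ffunE permM.
case: unliftP => [b|] ->; last by rewrite take0 lift_perm_id tpermR.
have [e se] := perm_graph_source_surj p b; rewrite -se.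
pose B := split_block i j (set0 : {set arrow (perm_graph p)}).
have -> : (if source e == i then drop 0 (B i) else B (source e)) = B (source e).
  by case: eqP => // ->; rewrite drop0.
rewrite /B split_block_perm_graph /split_end inE andbT.
rewrite perm_graph_target lift_perm_lift.
case: eqP => [->|/eqP pe]; first by rewrite tpermL.
by rewrite tpermD ?neq_lift // (inj_eq (@lift_inj _ _)) eq_sym.
Qed.

Lemma split_ij_perm_graph :
  split_ij i j (Fin (perm_graph p) i) 0 0 = perm_graph (t_ij * lift_perm j j p).
Proof.
have [ei sei] := perm_graph_source_surj p i.
have endE (e : arrow (perm_graph p)) :
    split_end i j (Fin (perm_graph p) i) e = lift j (p (source e)).
  by rewrite /split_end inE perm_graph_target andbN.
apply/ffunP => a; rewrite !ffunE permM take0 drop0.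
case: unliftP => [b|] ->; last first.
  have := split_block_perm_graph (Fin (perm_graph p) i) ei.
  rewrite endE sei => ->.
  by rewrite tpermR lift_perm_lift.
case: eqP => [->|/eqP bi]; first by rewrite tpermL lift_perm_id.
have [e se] := perm_graph_source_surj p b.
rewrite -se split_block_perm_graph endE tpermD ?neq_lift ?lift_perm_lift //.
by rewrite (inj_eq (@lift_inj _ _)) eq_sym se.
Qed.

Lemma size_split_block_perm_graph I a : size (split_block i j I a) = 1%N.
Proof. by rewrite size_split_block perm_graph_outdeg. Qed.

(** Were the arrow of [i] given to [j], the vertex [j] would have two outgoing
arrows; were the arrow ending at [i] kept there, it would meet the new arrow. *)
Lemma split_ji_perm_graph_uniq I (r t : nat) q :
  I \subset Fin (perm_graph p) i ->
  split_ji i j I r t = perm_graph q -> I = set0 /\ r = 0%N.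
Proof.
move=> /subsetP subI /ffunP Dq.
have r0 : r = 0%N.
  have /(congr1 size) := Dq j; rewrite !ffunE unlift_none size_insert size_take.
  by rewrite size_split_block_perm_graph; case: r Dq => // -[].
split=> //; subst r; apply/setP => e; rewrite inE; apply/negP => Ie.
have := Dq j; rewrite !ffunE unlift_none take0 /insert /= => -[qj].
have := Dq (lift j (source e)); rewrite !ffunE liftK drop0.
have -> : (if source e == i then split_block i j I i
           else split_block i j I (source e)) = split_block i j I (source e).
  by case: eqP => // ->.
rewrite split_block_perm_graph /split_end Ie andbF => -[].
have := subI _ Ie; rewrite inE => /eqP ->; rewrite qj => /perm_inj/eqP.
by rewrite (negbTE (neq_lift _ _)).
Qed.

Lemma split_ij_perm_graph_uniq I (r s : nat) q :
  I \subset Fin (perm_graph p) i ->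
  split_ij i j I r s = perm_graph q -> I = Fin (perm_graph p) i /\ r = 0%N.
Proof.
move=> /subsetP subI /ffunP Dq.
have r0 : r = 0%N.
  have /(congr1 size) := Dq (lift j i).
  rewrite !ffunE liftK eqxx size_insert size_take.
  by rewrite size_split_block_perm_graph; case: r Dq => // -[].
split=> //; subst r; apply/setP => e; apply/idP/idP => [/subI //|Fe].
apply/negPn/negP => nIe.
have := Dq (lift j i); rewrite !ffunE liftK eqxx take0 /insert /= => -[qi].
have end_j : split_end i j I e = j.
  by move: Fe; rewrite /split_end inE nIe andbT => ->.
case: (eqVneq (source e) i) => ei.
  have := Dq j; rewrite !ffunE unlift_none drop0.
  have := split_block_perm_graph I e; rewrite ei end_j => -> -[].
  by rewrite {1}qi => /perm_inj/eqP; rewrite eq_sym (negbTE (neq_lift _ _)).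
have := Dq (lift j (source e)).
rewrite !ffunE liftK (negbTE ei) split_block_perm_graph end_j => -[].
by rewrite {1}qi => /perm_inj/lift_inj/esym/eqP; rewrite (negbTE ei).
Qed.

Lemma split_term_perm_graph q q' e :
  split_term R i j (perm_graph q) (perm_graph q') e = (-1) ^+ e * (q == q')%:R.
Proof.
rewrite /split_term perm_graph_ascending /proper_at.
rewrite !perm_graph_outdeg !perm_graph_indeg /=.
by rewrite (inj_eq (@perm_graph_inj _)); case: eqP; rewrite ?mulr1 ?mulr0.
Qed.

Lemma outdeg_before_perm_graph q a : outdeg_before (perm_graph q) a = a.
Proof.
rewrite /outdeg_before; under eq_bigr do rewrite perm_graph_outdeg.
by rewrite (big_ord_narrow (ltnW (ltn_ord a))) sum1_card card_ord.
Qed.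

Lemma sum_split_single (F : {set arrow (perm_graph p)} -> nat -> nat -> R) I0 m :
  I0 \subset Fin (perm_graph p) i ->
  (forall I r t, I \subset Fin (perm_graph p) i -> ~ (I = I0 /\ r = 0%N) ->
     F I r t = 0) ->
  \sum_(I : {set arrow (perm_graph p)} | I \subset Fin (perm_graph p) i)
    \sum_(r < m.+1) \sum_(t < r.+1) F I r t = F I0 0%N 0%N.
Proof.
move=> subI0 F0; rewrite (bigD1 I0) //= big_ord_recl big_ord1 !big1 ?addr0 //.
  move=> I /andP[subI nI]; rewrite big1 // => r _; rewrite big1 // => t _.
  by apply: F0 => // -[eqI _]; rewrite eqI eqxx in nI.
by move=> r _; rewrite big1 // => t _; apply: F0 => // -[].
Qed.

Lemma mcoeff_split_sum_ji_perm_graph q :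
  (split_sum_ji R (perm_graph p) i j)@_(perm_graph q) =
  (-1) ^+ j * (lift_perm j j p * t_ij == q)%g%:R.
Proof.
rewrite mcoeff_split_sum_ji.
pose F (I : {set arrow (perm_graph p)}) r t :=
  split_term R i j (split_ji i j I r t) (perm_graph q)
    (sign_ji (split_ji i j I r t) (lift j i) j t).
rewrite (sum_split_single (F := F) _ (sub0set _)).
  rewrite /F split_ji_perm_graph split_term_perm_graph /sign_ji.
  rewrite perm_graph_outdeg !outdeg_before_perm_graph.
  by rewrite mul1n subnn mul0n !addn0.
move=> I r t subI nI; rewrite /F /split_term; case: and3P => // -[_ _ /eqP Dq].
by case: nI; apply: split_ji_perm_graph_uniq Dq.
Qed.

Lemma mcoeff_split_sum_ij_perm_graph q :
  (split_sum_ij R (perm_graph p) i j)@_(perm_graph q) =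
  - ((-1) ^+ j * (t_ij * lift_perm j j p == q)%g%:R).
Proof.
rewrite mcoeff_split_sum_ij.
pose F (I : {set arrow (perm_graph p)}) r s :=
  split_term R i j (split_ij i j I r s) (perm_graph q)
    (sign_ij (split_ij i j I r s) (lift j i) j s).
rewrite (sum_split_single (F := F) _ (subxx _)).
  rewrite /F split_ij_perm_graph split_term_perm_graph /sign_ij.
  rewrite !perm_graph_outdeg !outdeg_before_perm_graph.
  by rewrite mul1n subnn mul0n !addn0 addn1 exprS mulN1r mulNr.
move=> I r t subI nI; rewrite /F /split_term; case: and3P => // -[_ _ /eqP Dq].
by case: nI; apply: split_ij_perm_graph_uniq Dq.
Qed.

End SplitPermutation.

(** * The coboundary vanishes without isolated vertices *)

Lemma lift_perm_surj n (s : 'S_n.+1) (j : 'I_n.+1) :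
  exists t : 'S_n, s = lift_perm j (s j) t.
Proof.
pose f k := odflt k (unlift (s j) (s (lift j k))).
have fE k : lift (s j) (f k) = s (lift j k).
  have : s j != s (lift j k) by rewrite (inj_eq perm_inj) neq_lift.
  by case/unlift_some => l sl ul; rewrite /f ul /= -sl.
have f_inj : injective f.
  by move=> k l /(congr1 (lift (s j))); rewrite !fE => /perm_inj/lift_inj.
exists (perm f_inj); apply/permP => a.
case: (unliftP j a) => [k|] ->; last by rewrite lift_perm_id.
by rewrite lift_perm_lift permE fE.
Qed.

(** The permutation [q * tperm i j] has the sign opposite to that of [q].  When it
is odd and fixes [j], conjugation by itself fixes the argument of [E] and changes
the sign of the value.  When [q] is odd, conjugation by [q] permutes the terms of
the sum and changes their sign. *)
Lemma equivariant_sum_eq0 (R : realType) m (E : 'S_m -> 'I_m -> R) (q : 'S_m) :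
  (forall (r s : 'S_m) j, E (r ^ s)%g (s j) = (-1) ^+ s * E r j) ->
  (forall (r : 'S_m) j, r j != j -> E r j = 0) ->
  \sum_(i < m) \sum_(j < m | j != i) E (q * tperm i j)%g j = 0.
Proof.
move=> EJ E0; case: (boolP (odd_perm q)) => oddq; last first.
  rewrite big1 // => i _; rewrite big1 // => j ji.
  set r := (q * _)%g.
  case: (eqVneq (r j) j) => [rj|]; last exact: E0.
  apply: eq_opp0; have := EJ r r j; rewrite conjg_self rj => {1}->.
  by rewrite /r odd_permM odd_tperm eq_sym ji addbT oddq mulN1r.
apply: eq_opp0; rewrite {1}(reindex_inj (@perm_inj _ q)) -mulN1r mulr_sumr.
apply: eq_bigr => i _; rewrite {1}(reindex_inj (@perm_inj _ q)) /= mulr_sumr.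
apply: eq_big => [j|j _]; first by rewrite (inj_eq perm_inj).
by rewrite -tpermJ -[X in (X * _)%g](conjg_self q) -conjMg EJ oddq expr1.
Qed.

Lemma sum_lift_lt (R : realType) n (G : 'I_n.+1 -> 'I_n.+1 -> R) :
  \sum_(i < n) \sum_(j < n.+1 | (i < j)%N) G (lift j i) j =
  \sum_(i < n.+1) \sum_(j < n.+1 | (i < j)%N) G i j.
Proof.
rewrite (exchange_big_dep xpredT) //= [RHS](exchange_big_dep xpredT) //=.
apply: eq_bigr => j _.
rewrite big_mkcond [RHS]big_mkcond /= [RHS](bigD1_ord j) //= ltnn add0r.
apply: eq_bigr => i _.
by have -> : (i < j)%N = (lift j i < j)%N by rewrite /= /bump; lia.
Qed.

Section Vanishing.
Variables (R : realType) (n : nat).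

Lemma mcoeff_partial (d : comb R n) (E : graph n.+1) :
  (partial d)@_E = \sum_(D <- msupp d) d@_D * (graph_coboundary R D)@_E.
Proof. by rewrite raddf_sum; apply: eq_bigr => D _; rewrite /= mcoeffZ. Qed.

Lemma sum_msupp_perm_graph (d : comb R n) (F : graph n -> R) :
  (forall D, D \in msupp d -> has_isolated D -> F D = 0) ->
  symmetric_combination d ->
  \sum_(D <- msupp d) d@_D * F D = \sum_p d@_(perm_graph p) * F (perm_graph p).
Proof.
move=> F0 [asc _ _].
have -> : \sum_p d@_(perm_graph p) * F (perm_graph p) =
    \sum_(D <- [fset perm_graph p | p in {: 'S_n}]%fset) d@_D * F D.
  rewrite big_imfset /=; last by move=> p q _ _; apply: perm_graph_inj.
  by rewrite big_enum.
pose graphs := [fset perm_graph p | p in {: 'S_n}]%fset.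
rewrite (big_fset_incl _ (fsubsetUl _ graphs)); last first.
  by move=> D _ /mcoeff_outdom ->; rewrite mul0r.
symmetry; apply: big_fset_incl; first exact: fsubsetUr.
move=> D; rewrite inE => /orP[suppD|->//] notp.
case: (boolP (has_isolated D)) => [/F0->//|]; first by rewrite mulr0.
move=> /(ascending_perm_graph (asc _ suppD))[p Dp]; case/negP: notp.
by rewrite Dp; apply/imfsetP; exists p.
Qed.

(** The value of [d] at the permutation obtained by deleting the fixed point [j] of
[r], up to the sign needed for equivariance; it is 0 when [j] is not fixed, the
sum having at most one nonzero term. *)
Definition lifted_coeff (d : comb R n) (r : 'S_n.+1) (j : 'I_n.+1) : R :=
  (-1) ^+ j * \sum_p d@_(perm_graph p) * (lift_perm j j p == r)%:R.

Lemma lifted_coeff_fix (d : comb R n) (r : 'S_n.+1) j :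
  r j != j -> lifted_coeff d r j = 0.
Proof.
move=> rj; rewrite /lifted_coeff big1 ?mulr0 // => p _.
case: (lift_perm j j p =P r) rj => [<-|_ _]; last by rewrite mulr0.
by rewrite lift_perm_id eqxx.
Qed.

Lemma lifted_coeffJ (d : comb R n) (r s : 'S_n.+1) j :
  symmetric_combination d ->
  lifted_coeff d (r ^ s)%g (s j) = (-1) ^+ s * lifted_coeff d r j.
Proof.
move=> symd; have [t st] := lift_perm_surj s j.
rewrite /lifted_coeff (reindex_inj (conjg_inj t)) !mulr_sumr /=.
apply: eq_bigr => p _; rewrite symmetric_perm_graphJ //.
have -> : lift_perm (s j) (s j) (p ^ t)%g = (lift_perm j j p ^ s)%g.
  by rewrite {3}st [RHS]conjgE lift_permV !lift_permM -conjgE.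
rewrite (inj_eq (conjg_inj s)) !mulrA; congr (_ * _ * _).
rewrite {2}st odd_lift_perm -[(-1) ^+ s j]signr_odd -[(-1) ^+ j]signr_odd.
rewrite -!signr_addb; congr ((-1) ^+ nat_of_bool _).
by case: (odd j); case: (odd _); case: (odd_perm t).
Qed.

(** With [E = lifted_coeff d], the two splittings of [i] with new vertex [j]
contribute [E (q * tperm i j) j] and [- E (tperm i j * q) j], up to a common
sign.  Conjugation by [tperm i j] turns the second into [E (q * tperm i j) i],
which is the first for the pair in the other order, so that
[equivariant_sum_eq0] applies. *)
Lemma partial_perm_graph (d : comb R n) (q : 'S_n.+1) :
  symmetric_combination d -> (partial d)@_(perm_graph q) = 0.
Proof.
move=> symd; have [asc _ _] := symd.
rewrite mcoeff_partial sum_msupp_perm_graph //; last first.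
  move=> D suppD isoD; apply: mcoeff_graph_coboundary_eq0; first exact: asc.
  by rewrite isoD; have := perm_graph_no_isolated q; case: has_isolated.
pose E := lifted_coeff d.
have EJ r s j : E (r ^ s)%g (s j) = (-1) ^+ s * E r j by exact: lifted_coeffJ.
transitivity (- \sum_(i < n.+1) \sum_(j < n.+1 | (i < j)%N)
   (E (q * tperm i j)%g j - E (tperm i j * q)%g j)).
  rewrite -(sum_lift_lt
    (fun i j => E (q * tperm i j)%g j - E (tperm i j * q)%g j)).
  under eq_bigr => p _ do rewrite mcoeff_graph_coboundary mulrN mulr_sumr.
  rewrite sumrN exchange_big /=; congr (- _); apply: eq_bigr => i _.
  under eq_bigr => p _ do rewrite mulr_sumr.
  rewrite exchange_big /=; apply: eq_bigr => j _.
  rewrite /E /lifted_coeff -mulrBr -sumrB mulr_sumr; apply: eq_bigr => p _.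
  rewrite mcoeff_split_sum_ji_perm_graph mcoeff_split_sum_ij_perm_graph.
  set t := tperm _ _.
  have -> : (lift_perm j j p * t == q)%g = (lift_perm j j p == q * t)%g.
    by rewrite -(inj_eq (mulIg t)) -mulgA /t tperm2 mulg1.
  have -> : (t * lift_perm j j p == q)%g = (lift_perm j j p == t * q)%g.
    by rewrite -(inj_eq (mulgI t)) mulgA /t tperm2 mul1g.
  by rewrite -!mulrBr mulrCA.
apply/eqP; rewrite oppr_eq0; apply/eqP.
rewrite -[RHS](equivariant_sum_eq0 q EJ (@lifted_coeff_fix d)).
have Eopp i j : i != j -> E (tperm i j * q)%g j = - E (q * tperm i j)%g i.
  move=> ij; have := EJ (q * tperm i j)%g (tperm i j) i.
  rewrite tpermL conjgE tpermV -!mulgA tperm2 mulg1.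
  by rewrite odd_tperm ij expr1 mulN1r.
transitivity (\sum_(i < n.+1)
    (\sum_(j < n.+1 | (i < j)%N) E (q * tperm i j)%g j +
     \sum_(j < n.+1 | (j < i)%N) E (q * tperm i j)%g j)).
  rewrite big_split /= [X in _ = _ + X](exchange_big_dep xpredT) //=.
  rewrite -big_split /=.
  apply: eq_bigr => i _; rewrite -big_split /=; apply: eq_bigr => j ij.
  rewrite Eopp ?opprK; last by apply: contraTneq ij => ->; rewrite ltnn.
  by rewrite [tperm j i]tpermC.
apply: eq_bigr => i _; rewrite [RHS](bigID (fun j : 'I_n.+1 => (i < j)%N)) /=.
by congr (_ + _); apply: eq_bigl => j; rewrite -val_eqE /=; lia.
Qed.

Lemma msupp_partial (d : comb R n) (E : graph n.+1) :
  symmetric_combination d -> E \in msupp (partial d) ->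
  has_isolated E /\ exists2 D, D \in msupp d & has_isolated D.
Proof.
move=> symd; have [asc _ _] := symd; rewrite -mcoeff_neq0 => nzE.
have source_ex : exists2 D, D \in msupp d &
    ascending E && (has_isolated E == has_isolated D).
  apply/hasP; apply: contraNT nzE => /hasPn none; apply/eqP.
  rewrite mcoeff_partial big_seq big1 // => D suppD.
  rewrite mcoeff_graph_coboundary_eq0 ?mulr0 ?asc // => ascE.
  by have := none D suppD; rewrite ascE.
have [D suppD /andP[ascE /eqP isoED]] := source_ex.
case: (boolP (has_isolated E)) => [isoE|].
  by split=> //; exists D; rewrite // -isoED.
move=> /(ascending_perm_graph ascE)[q Eq].
by rewrite Eq partial_perm_graph ?eqxx in nzE.
Qed.

Lemma partial_eq0 (d : comb R n) :
  symmetric_combination d -> no_isolated_vertex d -> partial d = 0.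
Proof.
move=> symd noiso; apply/malgP => E; rewrite mcoeff0.
case: msuppP => // /(msupp_partial symd)[_ [D suppD isoD]].
by have := no_isolated_vertexP noiso suppD; rewrite isoD.
Qed.

Lemma no_isolated_partial_eq0 (d : comb R n) :
  symmetric_combination d -> no_isolated_vertex (partial d) -> partial d = 0.
Proof.
move=> symd noiso; apply/malgP => E; rewrite mcoeff0.
case: msuppP => // suppE; have [isoE _] := msupp_partial symd suppE.
by have := no_isolated_vertexP noiso suppE; rewrite isoE.
Qed.

End Vanishing.

(** * Wheels *)

Section PermSum.
Variables (m n : nat) (p : 'S_m) (q : 'S_n).
Local Open Scope group_scope.

Definition perm_sum_fun (x : 'I_(m + n)) : 'I_(m + n) :=
  match split x with inl a => lshift n (p a) | inr b => rshift m (q b) end.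

Lemma perm_sum_inj : injective perm_sum_fun.
Proof.
move=> x y; rewrite -(splitK x) -(splitK y) /perm_sum_fun !unsplitK.
case: (split x) (split y) => a [] b /eqP.
- by rewrite eq_lshift => /eqP/perm_inj->.
- by rewrite eq_lrshift.
- by rewrite eq_rlshift.
- by rewrite eq_rshift => /eqP/perm_inj->.
Qed.

Definition perm_sum := perm perm_sum_inj.

Lemma perm_sum_lshift a : perm_sum (lshift n a) = lshift n (p a).
Proof. by rewrite permE /perm_sum_fun (unsplitK (inl a)). Qed.

Lemma perm_sum_rshift b : perm_sum (rshift m b) = rshift m (q b).
Proof. by rewrite permE /perm_sum_fun (unsplitK (inr b)). Qed.

Lemma perm_graph_perm_sum :
  disjoint_union (perm_graph p) (perm_graph q) = perm_graph perm_sum.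
Proof.
apply/ffunP => x; rewrite !ffunE -(splitK x) unsplitK.
by case: (split x) => a /=; rewrite ffunE ?perm_sum_lshift ?perm_sum_rshift.
Qed.

Lemma porbit_lshift a : porbit perm_sum (lshift n a) = lshift n @: porbit p a.
Proof. exact/porbit_semiconj/perm_sum_lshift. Qed.

Lemma porbit_rshift b :
  porbit perm_sum (rshift m b) = @rshift m n @: porbit q b.
Proof. exact/porbit_semiconj/perm_sum_rshift. Qed.

Lemma card_porbit_lshift a : #|porbit perm_sum (lshift n a)| = #|porbit p a|.
Proof. by rewrite porbit_lshift card_imset //; apply: lshift_inj. Qed.

Lemma card_porbit_rshift b : #|porbit perm_sum (rshift m b)| = #|porbit q b|.
Proof. by rewrite porbit_rshift card_imset //; apply: rshift_inj. Qed.

End PermSum.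

Definition cycle_perm r : 'S_r := perm (@ordS_inj r).

Lemma porbit_cycle r (x : 'I_r) : porbit (cycle_perm r) x = setT.
Proof.
have r_gt0 : (0 < r)%N by exact: leq_ltn_trans (ltn_ord x).
have cX k : val ((cycle_perm r ^+ k)%g x) = ((x + k) %% r)%N.
  elim: k => [|k IH]; first by rewrite perm1 addn0 modn_small.
  by rewrite expgSr permM permE /= IH -addn1 modnDml -addnA addn1.
apply/setP => y; rewrite inE; apply/porbitP; exists (y + r - x)%N.
apply: val_inj; rewrite cX subnKC.
  by rewrite modnDr modn_small.
by rewrite (leq_trans (ltnW (ltn_ord x))) ?leq_addl.
Qed.

(** The cycles of [w] have distinct lengths, which are the elements of [rs]. *)
Record has_cycle_lengths n (w : 'S_n) (rs : seq nat) : Prop := CycleLengths {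
  card_porbit_in : forall x, #|porbit w x| \in rs;
  card_porbit_onto : forall r, r \in rs -> exists x, #|porbit w x| = r;
  card_porbit_inj : forall x y, #|porbit w x| = #|porbit w y| -> y \in porbit w x }.

Lemma wheel_union_perm rs : uniq rs -> all (leq 1) rs ->
  exists2 w : 'S_(sumn rs), wheel_union rs = perm_graph w & has_cycle_lengths w rs.
Proof.
elim: rs => [_ _|r rs IH] /=.
  by exists 1%g; [apply/ffunP => -[] | split => [[]|//|[]]].
case/andP=> rNrs /IH{}IH /andP[r_gt0 /IH[w ww [win wonto winj]]].
have wheelE : simple_wheel r = perm_graph (cycle_perm r).
  by apply/ffunP => a; rewrite !ffunE permE.
have card_cycle a : #|porbit (cycle_perm r) a| = r.
  by rewrite porbit_cycle cardsT card_ord.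
exists (perm_sum (cycle_perm r) w); first by rewrite wheelE ww perm_graph_perm_sum.
split=> [x|l|x y].
- rewrite -(splitK x); case: (split x) => a /=.
    by rewrite card_porbit_lshift card_cycle mem_head.
  by rewrite card_porbit_rshift inE win orbT.
- rewrite inE => /orP[/eqP->|/wonto[x <-]].
    by exists (lshift _ (Ordinal r_gt0)); rewrite card_porbit_lshift.
  by exists (rshift _ x); rewrite card_porbit_rshift.
- rewrite -(splitK x) -(splitK y); case: (split x) (split y) => a [] b /=;
    rewrite ?card_porbit_lshift ?card_porbit_rshift ?card_cycle
      ?porbit_lshift ?porbit_rshift.
  + by move=> _; apply: imset_f; rewrite porbit_cycle inE.
  + by move=> rb; rewrite rb win in rNrs.
  + by move=> ra; rewrite -ra win in rNrs.
  + by move=> /winj; apply: imset_f.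
Qed.

Lemma wheel_lengths_uniq ks : sorted ltn ks -> uniq (wheel_lengths ks).
Proof.
move=> /sorted_uniq s; rewrite map_inj_uniq.
  by apply: s => [|x]; [exact: ltn_trans | exact: ltnn].
by move=> k l []; lia.
Qed.

Lemma cast_graph_id n (e : n = n) (D : graph n) : cast_graph e D = D.
Proof.
apply/ffunP => a; rewrite ffunE cast_ord_id.
by apply: map_id_in => b _; rewrite cast_ord_id.
Qed.

Lemma wheel_product_wedge (R : realType) n (x : wheel_index n) :
  exists w : 'S_n, [/\ wheel_product R x = wedge R w, rigid w &
    has_cycle_lengths w (wheel_lengths (val x))].
Proof.
have [sorted_x _] := andP (valP x).
have [|w ww lw] := wheel_union_perm (wheel_lengths_uniq sorted_x).
  by apply/allP => r /mapP[k _ ->].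
have rigw : rigid w.
  split; last exact: card_porbit_inj lw.
  by move=> y; have /mapP[k _ ->] := card_porbit_in lw y; rewrite /= odd_double.
rewrite /wheel_product; move: (wheel_index_sum x) => e; rewrite {}ww.
move: (wheel_lengths _) e w lw rigw => rs; clear sorted_x x => e.
subst n => w lw rigw.
by exists w; rewrite cast_graph_id.
Qed.

(** The integers [k] such that [w] has a cycle of length [k.*2.+1], when all its
cycles have odd length. *)
Definition half_lengths n (w : 'S_n) : seq nat :=
  sort leq (undup [seq #|porbit w x|./2 | x : 'I_n]).

Lemma half_lengths_index n (w : 'S_n) : rigid w ->
  sorted ltn (half_lengths w) && (sumn (wheel_lengths (half_lengths w)) == n).
Proof.
move=> [oddw winj]; set ks := half_lengths w.
have sort_ks : sorted ltn ks.
  by rewrite ltn_sorted_uniq_leq sort_uniq undup_uniq (sort_sorted leq_total).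
have mem_ks k : (k \in ks) = (k \in [seq #|porbit w x|./2 | x : 'I_n]).
  by rewrite mem_sort mem_undup.
have uniq_ks : uniq ks by rewrite sort_uniq undup_uniq.
have lenE y : #|porbit w y| = (#|porbit w y|./2).*2.+1.
  by rewrite -[LHS]odd_double_half oddw.
rewrite sort_ks /= sumnE big_map; apply/eqP.
(* Points are counted according to the length of their cycle: a length is taken
   by the points of a single cycle, and their number is this length. *)
transitivity (\sum_(k <- ks) \sum_(x < n | #|porbit w x|./2 == k) 1)%N.
  apply: eq_big_seq => k; rewrite mem_ks => /codomP[y ky].
  rewrite sum1_card ky -lenE; apply: eq_card => x.
  rewrite [RHS]unfold_in -/(_ == _).
  apply/idP/eqP => [|xy]; last by apply: winj; rewrite lenE -xy -lenE.
  by rewrite -eq_porbit_mem => /eqP ->.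
under eq_bigr do rewrite big_mkcond.
rewrite exchange_big /= -[RHS]card_ord -sum1_card; apply: eq_bigr => x _.
rewrite (bigD1_seq (#|porbit w x|./2)) ?eqxx //=; last first.
  by rewrite mem_ks; apply: codom_f.
by rewrite big1 // => k; rewrite eq_sym => /negbTE ->.
Qed.

Lemma rigid_wheel (R : realType) n (p : 'S_n) : rigid p ->
  exists x : wheel_index n, exists s : 'S_n,
    wedge R p = (-1) ^+ s *: wheel_product R x.
Proof.
move=> rigp.
pose indexed ks := sorted ltn ks && (sumn (wheel_lengths ks) == n).
pose x : wheel_index n :=
  exist indexed (half_lengths p) (half_lengths_index rigp).
exists x; have [w [-> rigw lw]] := wheel_product_wedge R x.
have [y|s ->] := rigid_conjugate rigw (q := p).
  have /mapP[k] := card_porbit_in lw y.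
  rewrite mem_sort mem_undup => /codomP[z ->] ->.
  by exists z; have [oddp _] := rigp; rewrite -[LHS]odd_double_half oddp.
by exists s; rewrite wedgeJ.
Qed.

(** The witness is the disjoint union of the wheels of [x].  Its coefficient in the
product indexed by [x] is, up to sign, the order of its centralizer, since all
the permutations which fix it are even.  In any other product the graphs have
other cycle lengths. *)
Lemma wheel_product_separated (R : realType) n (x : wheel_index n) :
  exists E, forall y, ((wheel_product R y)@_E != 0) = (y == x).
Proof.
have [w [_ rigw lw]] := wheel_product_wedge R x.
exists (perm_graph w) => y; have [v [-> rigv lv]] := wheel_product_wedge R y.
apply/idP/eqP => [|yx].
  rewrite mcoeff_neq0 => /msupp_wedge[s /perm_graph_inj ws].
  have eq_len : wheel_lengths (val y) =i wheel_lengths (val x).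
    move=> m; apply/idP/idP => [/(card_porbit_onto lv)|/(card_porbit_onto lw)]
      [a <-].
      by rewrite -(card_porbitJ v s) -ws (card_porbit_in lw).
    rewrite ws -[a](permKV s) card_porbitJ; exact: (card_porbit_in lv).
  apply: val_inj; apply: (irr_sorted_eq ltn_trans ltnn).
  - by have [] := andP (valP y).
  - by have [] := andP (valP x).
  move=> k; have := eq_len k.*2.+1.
  by rewrite !mem_map // => a b []; lia.
have [s ->] : exists s, v = (w ^ s)%g.
  apply: (rigid_conjugate rigw) => a.
  have := card_porbit_in lw a; rewrite -yx => /(card_porbit_onto lv)[b <-].
  by exists b.
rewrite wedgeJ mcoeffZ mulf_neq0 ?signr_eq0 // mcoeff_wedge.
under eq_bigr => t _.
  have -> : (-1) ^+ odd_perm t * (perm_graph (w ^ t)%g == perm_graph w)%:R =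
     (perm_graph (w ^ t)%g == perm_graph w)%:R :> R.
    case: eqP => [/perm_graph_inj wt|_]; last by rewrite mulr0.
    by rewrite (rigid_centralizer_even rigw wt) mulr1.
  over.
rewrite -natr_sum pnatr_eq0 -lt0n (bigD1 1%g) //= conjg1 eqxx.
by [].
Qed.

(** * The cohomology *)

Section LinearCombination.
Variables (R : realType) (V : lmodType R) (K : choiceType) (b : K -> V).
Implicit Types c : {malg R[K]}.

Lemma linear_combination_wide c (E : {fset K}) : (msupp c `<=` E)%fset ->
  linear_combination b c = \sum_(k <- E) c@_k *: b k.
Proof.
by move=> cE; apply: big_fset_incl => // k _ /mcoeff_outdom ->; rewrite scale0r.
Qed.

Lemma linear_combinationP a c c' :
  linear_combination b (a *: c + c') =
  a *: linear_combination b c + linear_combination b c'.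
Proof.
pose E := (msupp c `|` msupp c')%fset.
rewrite !(@linear_combination_wide _ E) ?fsubsetUl ?fsubsetUr //; last first.
  apply: fsubset_trans (msuppD_le _ _) _; apply: fsetSU; exact: msuppZ_le.
rewrite scaler_sumr -big_split /=; apply: eq_bigr => k _.
by rewrite mcoeffD mcoeffZ scalerDl scalerA.
Qed.

Lemma linear_combination0 : linear_combination b 0 = 0.
Proof. by rewrite /linear_combination msupp0 big_seq_fset0. Qed.

Lemma linear_combination_sum (I : finType) (a : I -> R) (c : I -> {malg R[K]}) :
  linear_combination b (\sum_i a i *: c i) =
  \sum_i a i *: linear_combination b (c i).
Proof.
elim/big_rec2: _ => [|i y c' _ <-]; first exact: linear_combination0.
exact: linear_combinationP.
Qed.

Lemma linear_combinationU k : linear_combination b << k >> = b k.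
Proof.
rewrite (linear_combination_wide (@msuppU_le _ _ _ _)).
by rewrite big_seq_fset1 mcoeffUU scale1r.
Qed.

End LinearCombination.

Lemma wedge_span (R : realType) n (p : 'S_n) :
  exists c, wedge R p = linear_combination (@wheel_product R n) c.
Proof.
have [/(@rigid_wheel R)[x [s ->]]|[s ps odds]] := rigid_or_odd_centralizer p.
  exists ((-1) ^+ s *: << x >>).
  rewrite -[_ *: << x >>]addr0 linear_combinationP linear_combinationU.
  by rewrite linear_combination0 addr0.
by exists 0; rewrite (wedge_eq0 _ ps odds) linear_combination0.
Qed.

Lemma wheel_product_cocycle (R : realType) n (x : wheel_index n) :
  cocycle (wheel_product R x) /\ no_isolated_vertex (wheel_product R x).
Proof.
have [w [-> _ _]] := wheel_product_wedge R x.
have [symw now] := (wedge_symmetric R w, @wedge_no_isolated R n w).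
by split=> //; split=> //; apply: partial_eq0.
Qed.

Lemma coboundary_eq0 (R : realType) n (d : comb R n) :
  coboundary d -> no_isolated_vertex d -> d = 0.
Proof.
case: n d => [|[|m]] d //= [e syme ->]; exact: no_isolated_partial_eq0.
Qed.

Lemma symmetric_combination0 (R : realType) n :
  symmetric_combination (0 : comb R n).
Proof.
by split=> [D|D i s|D i j _]; rewrite ?msupp0 ?inE // !mcoeff0 mulr0.
Qed.

Lemma coboundary0 (R : realType) n : coboundary (0 : comb R n).
Proof.
case: n => [|[|m]] //=; exists 0; first exact: symmetric_combination0.
by rewrite /partial msupp0 big_seq_fset0.
Qed.

Theorem mainTheorem1 (R : realType) (n : nat) (hn : (0 < n)%N) :
  quotient_basis
    (fun d : comb R n => cocycle d /\ no_isolated_vertex d)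
    (fun d : comb R n => coboundary d /\ no_isolated_vertex d)
    (@wheel_product R n).
Proof.
have noiso0 : no_isolated_vertex (0 : comb R n) by move=> D; rewrite msupp0.
have sym0 := symmetric_combination0 R n.
split.
- move=> d [/coboundary_eq0 d0 /d0 ->].
  by split=> //; split=> //; apply: partial_eq0.
- exact: wheel_product_cocycle.
- move=> c [/coboundary_eq0 c0 /c0 {}c0]; apply/malgP => x; rewrite mcoeff0.
  have [E wE] := wheel_product_separated R x.
  have := congr1 (mcoeff E) c0; rewrite mcoeff0 raddf_sum /=.
  case: (msuppP c x) => // suppx.
  rewrite (big_fsetD1 x) //= big_seq big1 => [|y].
    have := wE x; rewrite eqxx => /negbTE wxE.
    by rewrite addr0 mcoeffZ => /eqP; rewrite mulf_eq0 wxE orbF => /eqP.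
  rewrite !inE => /andP[yx _]; rewrite mcoeffZ.
  by have := wE y; rewrite (negbTE yx) => /negbFE/eqP ->; rewrite mulr0.
- move=> d [[symd _] noisod].
  have [c cE] := fin_all_exists (@wedge_span R n).
  exists (\sum_p (d@_(perm_graph p) / n`!%:R) *: c p).
  rewrite linear_combination_sum.
  under eq_bigr do rewrite -cE.
  rewrite -symmetric_sum_wedge // subrr; split=> //.
  exact: coboundary0.
Qed.
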